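(* There does not exist a model structure on $\mathbf{DblCat}$ such that a double functor $K$ is a weak equivalence (respectively fibration) if and only if $N_hK$ is a weak equivalence (respectively fibration) in the Reedy model structure on $\mathbf{Cat}^{\Delta^{op}}$ associated to the categorical model structure on $\mathbf{Cat}$.
   Context: A small double category $\mathbb{D}$ is an internal category in $\mathbf{Cat}$: it consists of a category $\mathbb{D}_0$ (objects and vertical morphisms), a category $\mathbb{D}_1$ (horizontal morphisms and squares, composed vertically), and source, target, unit and horizontal composition functors satisfying the category axioms. A double functor is an internal functor in $\mathbf{Cat}$; $\mathbf{DblCat}$ is the category of small double categories and double functors. The horizontal nerve $N_h:\mathbf{DblCat}\to\mathbf{Cat}^{\Delta^{op}}$ sends $\mathbb{D}$ to the simplicial object in $\mathbf{Cat}$ with $(N_h\mathbb{D})_0=\mathbb{D}_0$, $(N_h\mathbb{D})_1=\mathbb{D}_1$, and $(N_h\mathbb{D})_n=\mathbb{D}_1\times_{\mathbb{D}_0}\cdots\times_{\mathbb{D}_0}\mathbb{D}_1$ ($n$ copies) for $n\geq 2$, with the usual nerve face and degeneracy functors. The categorical model structure on $\mathbf{Cat}$ has weak equivalences the equivalences of categories, fibrations the isofibrations (functors $F:\mathbf{A}\to\mathbf{B}$ such that every isomorphism $b\cong Fa$ in $\mathbf{B}$ lifts to an isomorphism $a'\cong a$ in $\mathbf{A}$), and cofibrations the functors injective on objects. In the associated Reedy model structure on $\mathbf{Cat}^{\Delta^{op}}$ the weak equivalences are the levelwise equivalences of categories, and the fibrations are the Reedy fibrations: maps $X\to Y$ such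 that for each $n\ge 0$ the induced functor $X_n\to Y_n\times_{M_nY}M_nX$ is an isofibration, where $M_n$ denotes the $n$-th matching object. *)

(* Defs.v *)
From Stdlib Require Import FunctionalExtensionality ProofIrrelevance.
From mathcomp Require Import all_boot.

Set Implicit Arguments.
Unset Strict Implicit.
Unset Printing Implicit Defensive.

Record Category := MkCategory {
  obj :> Type;
  hom : obj -> obj -> Type;
  idm : forall x, hom x x;
  compose : forall x y z, hom y z -> hom x y -> hom x z;
  compose_1l : forall x y (f : hom x y), compose (idm y) f = f;
  compose_1r : forall x y (f : hom x y), compose f (idm x) = f;
  compose_A : forall x y z w (h : hom z w) (g : hom y z) (f : hom x y),
    compose h (compose g f) = compose (compose h g) f
}.

Arguments hom {c} _ _.
Arguments idm {c} x.
Arguments compose {c x y z} _ _.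

Declare Scope category_scope.
Delimit Scope category_scope with Cat.
Notation "g ∘ f" := (compose g f)
  (at level 40, left associativity) : category_scope.
Local Open Scope category_scope.

Definition opposite (A : Category) : Category :=
  {| obj := obj A;
     hom := fun x y => hom y x;
     idm := fun x => idm x;
     compose := fun x y z g f => compose (c := A) f g;
     compose_1l := fun x y f => compose_1r f;
     compose_1r := fun x y f => compose_1l f;
     compose_A := fun x y z w h g f => esym (compose_A f g h) |}.

Record Functor (A B : Category) := MkFunctor {
  fobj :> A -> B;
  fmap : forall x y, hom x y -> hom (fobj x) (fobj y);
  fmap_id : forall x, fmap (idm x) = idm (fobj x);
  fmap_comp : forall x y z (g : hom y z) (f : hom x y),
    fmap (g ∘ f) = fmap g ∘ fmap f
}.

Record NatTrans (A B : Category) (F G : Functor A B) := MkNatTrans {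
  component :> forall x : A, hom (F x) (G x);
  naturality : forall x y (f : hom x y),
    component y ∘ fmap F f = fmap G f ∘ component x
}.

Lemma NatTrans_ext (A B : Category) (F G : Functor A B) (a b : NatTrans F G) :
  (forall x, a x = b x) -> a = b.
Proof.
case: a b => [a Ha] [b Hb] /= E.
have {}E : a = b by apply: functional_extensionality_dep.
by case: _ / E Hb => Hb; congr MkNatTrans; apply: proof_irrelevance.
Qed.

Definition nat_id (A B : Category) (F : Functor A B) : NatTrans F F.
Proof.
refine {| component := fun x => idm (F x) |}.
abstract (by move=> x y f; rewrite compose_1l compose_1r).
Defined.

Definition nat_comp (A B : Category) (F G H : Functor A B)
  (b : NatTrans G H) (a : NatTrans F G) : NatTrans F H.
Proof.
refine {| component := fun x => b x ∘ a x |}.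
abstract (by move=> x y f;
  rewrite -compose_A naturality compose_A naturality compose_A).
Defined.

Definition FunctorCategory (A B : Category) : Category.
Proof.
refine {| obj := Functor A B; hom := @NatTrans A B;
          idm := @nat_id A B; compose := @nat_comp A B |}.
- by move=> F G a; apply: NatTrans_ext => x; apply: compose_1l.
- by move=> F G a; apply: NatTrans_ext => x; apply: compose_1r.
- by move=> F G H L c b a; apply: NatTrans_ext => x; apply: compose_A.
Defined.

Definition is_retract (A : Category) (x y x' y' : A)
    (f : hom x y) (g : hom x' y') : Prop :=
  exists (i : hom x x') (r : hom x' x) (j : hom y y') (q : hom y' y),
    [/\ r ∘ i = idm x, q ∘ j = idm y, g ∘ i = j ∘ f & f ∘ r = q ∘ g].

Definition has_lift (A : Category) (x y x' y' : A)
    (i : hom x y) (p : hom x' y') : Prop :=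
  forall (u : hom x x') (v : hom y y'), p ∘ u = v ∘ i ->
    exists l : hom y x', l ∘ i = u /\ p ∘ l = v.

(* Factorizations are not required to be functorial, and no limits or colimits
   are required of the underlying category. *)
Record ModelStructure (A : Category) := MkModelStructure {
  weq : forall x y : A, hom x y -> Prop;
  fib : forall x y : A, hom x y -> Prop;
  cof : forall x y : A, hom x y -> Prop;
  weq_comp : forall (x y z : A) (f : hom x y) (g : hom y z),
    weq f -> weq g -> weq (g ∘ f);
  weq_cancel_l : forall (x y z : A) (f : hom x y) (g : hom y z),
    weq g -> weq (g ∘ f) -> weq f;
  weq_cancel_r : forall (x y z : A) (f : hom x y) (g : hom y z),
    weq f -> weq (g ∘ f) -> weq g;
  weq_retract : forall (x y x' y' : A) (f : hom x y) (g : hom x' y'),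
    is_retract f g -> weq g -> weq f;
  fib_retract : forall (x y x' y' : A) (f : hom x y) (g : hom x' y'),
    is_retract f g -> fib g -> fib f;
  cof_retract : forall (x y x' y' : A) (f : hom x y) (g : hom x' y'),
    is_retract f g -> cof g -> cof f;
  lift_acyclic_cof : forall (x y x' y' : A) (i : hom x y) (p : hom x' y'),
    cof i -> weq i -> fib p -> has_lift i p;
  lift_acyclic_fib : forall (x y x' y' : A) (i : hom x y) (p : hom x' y'),
    cof i -> fib p -> weq p -> has_lift i p;
  factor_acyclic_cof : forall (x y : A) (f : hom x y),
    exists (z : A) (i : hom x z) (p : hom z y),
      [/\ f = p ∘ i, cof i, weq i & fib p];
  factor_acyclic_fib : forall (x y : A) (f : hom x y),
    exists (z : A) (i : hom x z) (p : hom z y),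
      [/\ f = p ∘ i, cof i, fib p & weq p]
}.

(* [m] is the ordinal {0, ..., m}, i.e. 'I_m.+1. *)
Record monotone (m n : nat) := MkMonotone {
  mfun :> 'I_m.+1 -> 'I_n.+1;
  mfun_le : forall i j : 'I_m.+1, i <= j -> mfun i <= mfun j
}.

Lemma monotone_ext m n (a b : monotone m n) : (forall i, a i = b i) -> a = b.
Proof.
case: a b => [a Ha] [b Hb] /= E.
have {}E : a = b by apply: functional_extensionality.
by case: _ / E Hb => Hb; congr MkMonotone; apply: proof_irrelevance.
Qed.

Definition mono_id n : monotone n n :=
  {| mfun := fun i => i; mfun_le := fun i j h => h |}.

Definition mono_comp l m n (a : monotone m n) (b : monotone l m) :
    monotone l n :=
  {| mfun := fun i => a (b i);
     mfun_le := fun i j h => mfun_le a (mfun_le b h) |}.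

Definition Delta : Category.
Proof.
refine {| obj := nat; hom := monotone; idm := mono_id;
          compose := mono_comp |}; by move=> *; apply: monotone_ext.
Defined.

Definition Simplicial (A : Category) : Category :=
  FunctorCategory (opposite Delta) A.

Record Pullbacks (A : Category) := MkPullbacks {
  pb : forall x y z : A, hom x z -> hom y z -> A;
  pb_p1 : forall (x y z : A) (f : hom x z) (g : hom y z), hom (pb f g) x;
  pb_p2 : forall (x y z : A) (f : hom x z) (g : hom y z), hom (pb f g) y;
  pb_square : forall (x y z : A) (f : hom x z) (g : hom y z),
    f ∘ pb_p1 f g = g ∘ pb_p2 f g;
  pb_pair : forall (x y z : A) (f : hom x z) (g : hom y z) (w : A)
    (a : hom w x) (b : hom w y), f ∘ a = g ∘ b -> hom w (pb f g);
  pb_pair1 : forall (x y z : A) (f : hom x z) (g : hom y z) (w : A)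
    (a : hom w x) (b : hom w y) (e : f ∘ a = g ∘ b),
    pb_p1 f g ∘ pb_pair e = a;
  pb_pair2 : forall (x y z : A) (f : hom x z) (g : hom y z) (w : A)
    (a : hom w x) (b : hom w y) (e : f ∘ a = g ∘ b),
    pb_p2 f g ∘ pb_pair e = b;
  pb_ext : forall (x y z : A) (f : hom x z) (g : hom y z) (w : A)
    (h k : hom w (pb f g)),
    pb_p1 f g ∘ h = pb_p1 f g ∘ k -> pb_p2 f g ∘ h = pb_p2 f g ∘ k -> h = k
}.

Arguments pb {A} p {x y z} f g.
Arguments pb_p1 {A} p {x y z} f g.
Arguments pb_p2 {A} p {x y z} f g.
Arguments pb_square {A} p {x y z} f g.
Arguments pb_pair {A} p {x y z f g w a b} e.

Definition pb_map (A : Category) (P : Pullbacks A) (x y z x' y' z' : A)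
    (f : hom x z) (g : hom y z) (f' : hom x' z') (g' : hom y' z')
    (a : hom x x') (b : hom y y') (c : hom z z')
    (ef : f' ∘ a = c ∘ f) (eg : g' ∘ b = c ∘ g) :
    hom (pb P f g) (pb P f' g').
Proof.
refine (pb_pair P (a := a ∘ pb_p1 P f g) (b := b ∘ pb_p2 P f g) _).
abstract (by rewrite !compose_A ef eg -!compose_A pb_square).
Defined.

(* [imul] is defined on pairs (f, g) with target f = source g and sends them to
   the composite "f followed by g".  The laws are stated on generalized
   elements; the compatibility proofs over which they quantify always exist. *)
Record InternalCategory (A : Category) (P : Pullbacks A) := MkInternal {
  iob : A;
  iar : A;
  isrc : hom iar iob;
  itgt : hom iar iob;
  iunit : hom iob iar;
  imul : hom (pb P itgt isrc) iar;
  isrc_unit : isrc ∘ iunit = idm iob;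
  itgt_unit : itgt ∘ iunit = idm iob;
  isrc_mul : isrc ∘ imul = isrc ∘ pb_p1 P itgt isrc;
  itgt_mul : itgt ∘ imul = itgt ∘ pb_p2 P itgt isrc;
  imul_1l : forall (w : A) (f : hom w iar)
    (e : itgt ∘ (iunit ∘ (isrc ∘ f)) = isrc ∘ f),
    imul ∘ pb_pair P e = f;
  imul_1r : forall (w : A) (f : hom w iar)
    (e : itgt ∘ f = isrc ∘ (iunit ∘ (itgt ∘ f))),
    imul ∘ pb_pair P e = f;
  imul_A : forall (w : A) (f g h : hom w iar)
    (efg : itgt ∘ f = isrc ∘ g) (egh : itgt ∘ g = isrc ∘ h)
    (el : itgt ∘ (imul ∘ pb_pair P efg) = isrc ∘ h)
    (er : itgt ∘ f = isrc ∘ (imul ∘ pb_pair P egh)),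
    imul ∘ pb_pair P el = imul ∘ pb_pair P er
}.

Record InternalFunctor (A : Category) (P : Pullbacks A)
    (D E : InternalCategory P) := MkInternalFunctor {
  ifob : hom (iob D) (iob E);
  ifar : hom (iar D) (iar E);
  if_src : isrc E ∘ ifar = ifob ∘ isrc D;
  if_tgt : itgt E ∘ ifar = ifob ∘ itgt D;
  if_unit : ifar ∘ iunit D = iunit E ∘ ifob;
  if_mul : ifar ∘ imul D = imul E ∘ pb_map P if_tgt if_src
}.

Section InternalCategories.
Variables (A : Category) (P : Pullbacks A).
Implicit Types D E : InternalCategory P.

Lemma InternalFunctor_ext D E (F G : InternalFunctor D E) :
  ifob F = ifob G -> ifar F = ifar G -> F = G.
Proof.
case: F G => [F0 F1 a b c d] [G0 G1 a' b' c' d'] /= E0 E1.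
case: _ / E0 a' b' c' d' => a' b' c' d'; case: _ / E1 a' b' c' d' => a' b' c' d'.
have Ea := proof_irrelevance _ a a'; case: _ / Ea d' => d'.
have Eb := proof_irrelevance _ b b'; case: _ / Eb d' => d'.
by congr MkInternalFunctor; apply: proof_irrelevance.
Qed.

Lemma pb_map_comp (x y z x' y' z' x'' y'' z'' : A)
    (f : hom x z) (g : hom y z) (f' : hom x' z') (g' : hom y' z')
    (f'' : hom x'' z'') (g'' : hom y'' z'')
    (a : hom x x') (b : hom y y') (c : hom z z')
    (a' : hom x' x'') (b' : hom y' y'') (c' : hom z' z'')
    (ef : f' ∘ a = c ∘ f) (eg : g' ∘ b = c ∘ g)
    (ef' : f'' ∘ a' = c' ∘ f') (eg' : g'' ∘ b' = c' ∘ g')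
    (ef'' : f'' ∘ (a' ∘ a) = (c' ∘ c) ∘ f)
    (eg'' : g'' ∘ (b' ∘ b) = (c' ∘ c) ∘ g) :
  pb_map P ef'' eg'' = pb_map P ef' eg' ∘ pb_map P ef eg.
Proof.
apply: pb_ext; rewrite [RHS]compose_A /pb_map !(pb_pair1, pb_pair2).
  by rewrite -[RHS]compose_A pb_pair1 compose_A.
by rewrite -[RHS]compose_A pb_pair2 compose_A.
Qed.

Definition internal_id D : InternalFunctor D D.
Proof.
unshelve refine {| ifob := idm (iob D); ifar := idm (iar D) |}.
- abstract (by rewrite compose_1l compose_1r).
- abstract (by rewrite compose_1l compose_1r).
- abstract (by rewrite compose_1l compose_1r).
- abstract (rewrite compose_1l -[LHS]compose_1r; congr (_ ∘ _);
    by apply: pb_ext;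
       rewrite /pb_map !(pb_pair1, pb_pair2) compose_1r compose_1l).
Defined.

Definition internal_comp D E F (K : InternalFunctor E F)
  (H : InternalFunctor D E) : InternalFunctor D F.
Proof.
unshelve refine {| ifob := ifob K ∘ ifob H; ifar := ifar K ∘ ifar H |}.
- abstract (by rewrite compose_A if_src -compose_A if_src compose_A).
- abstract (by rewrite compose_A if_tgt -compose_A if_tgt compose_A).
- abstract (by rewrite -compose_A if_unit compose_A if_unit compose_A).
- abstract (rewrite -compose_A if_mul compose_A if_mul -compose_A;
    congr (_ ∘ _); by symmetry; apply: pb_map_comp).
Defined.

Definition InternalCat : Category.
Proof.
refine {| obj := InternalCategory P; hom := @InternalFunctor A P;
          idm := internal_id; compose := internal_comp |}.
- by move=> D E F; apply: InternalFunctor_ext; apply: compose_1l.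
- by move=> D E F; apply: InternalFunctor_ext; apply: compose_1r.
- by move=> D E F G h g f; apply: InternalFunctor_ext; apply: compose_A.
Defined.

Lemma pb_pair_congr (x y z : A) (f : hom x z) (g : hom y z) (w : A)
    (a a' : hom w x) (b b' : hom w y)
    (e : f ∘ a = g ∘ b) (e' : f ∘ a' = g ∘ b') :
  a = a' -> b = b' -> pb_pair P e = pb_pair P e'.
Proof. by move=> Ea Eb; apply: pb_ext; rewrite !(pb_pair1, pb_pair2). Qed.

Lemma pb_pair_pre (x y z : A) (f : hom x z) (g : hom y z) (w w' : A)
    (a : hom w x) (b : hom w y) (h : hom w' w) (e : f ∘ a = g ∘ b)
    (e' : f ∘ (a ∘ h) = g ∘ (b ∘ h)) :
  pb_pair P e ∘ h = pb_pair P e'.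
Proof. by apply: pb_ext; rewrite compose_A !(pb_pair1, pb_pair2). Qed.

(* An infinite composable string of generalized elements of [iar D]: composable
   n-tuples are continued by units, which avoids range conditions. *)
Record path D (w : A) := MkPath {
  pe :> nat -> hom w (iar D);
  pe_next : forall k, itgt D ∘ pe k = isrc D ∘ pe k.+1
}.

Definition path_pre D w w' (p : path D w) (h : hom w' w) : path D w'.
Proof.
refine {| pe := fun k => p k ∘ h |}.
abstract (by move=> k; rewrite !compose_A pe_next).
Defined.

Definition path_tail D w (p : path D w) : path D w :=
  {| pe := fun k => p k.+1; pe_next := fun k => pe_next p k.+1 |}.

Definition path_map D E (F : InternalFunctor D E) w (p : path D w) : path E w.
Proof.
refine {| pe := fun k => ifar F ∘ p k |}.
abstract (by move=> k;
  rewrite !compose_A if_tgt if_src -!compose_A pe_next).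
Defined.

Lemma isrc_iunit D w (f : hom w (iar D)) :
  isrc D ∘ (iunit D ∘ (isrc D ∘ f)) = isrc D ∘ f.
Proof. by rewrite compose_A isrc_unit compose_1l. Qed.

Lemma isrc_imul D w (f g : hom w (iar D)) (e : itgt D ∘ f = isrc D ∘ g) :
  isrc D ∘ (imul D ∘ pb_pair P e) = isrc D ∘ f.
Proof. by rewrite compose_A isrc_mul -compose_A pb_pair1. Qed.

(* The composite of the [l] edges of [p] that start at vertex [i]. *)
Fixpoint seg_sig D w (p : path D w) (l i : nat) {struct l} :
    {c : hom w (iar D) | isrc D ∘ c = isrc D ∘ p i} :=
  match l with
  | 0 => exist _ (iunit D ∘ (isrc D ∘ p i)) (isrc_iunit (p i))
  | S l' => let c := seg_sig p l' i.+1 in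
      exist _ (imul D ∘ pb_pair P (etrans (pe_next p i) (esym (proj2_sig c))))
        (isrc_imul _)
  end.

Definition seg D w (p : path D w) (i l : nat) : hom w (iar D) :=
  proj1_sig (seg_sig p l i).

Lemma seg_src D w (p : path D w) i l : isrc D ∘ seg p i l = isrc D ∘ p i.
Proof. exact: (proj2_sig (seg_sig p l i)). Qed.

Lemma seg0 D w (p : path D w) i : seg p i 0 = iunit D ∘ (isrc D ∘ p i).
Proof. by []. Qed.

Lemma segS D w (p : path D w) i l (e : itgt D ∘ p i = isrc D ∘ seg p i.+1 l) :
  seg p i l.+1 = imul D ∘ pb_pair P e.
Proof. by rewrite /seg /=; congr (_ ∘ _); apply: pb_pair_congr. Qed.

Lemma segS_compat D w (p : path D w) i l :
  itgt D ∘ p i = isrc D ∘ seg p i.+1 l.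
Proof. by rewrite seg_src pe_next. Qed.

Lemma seg_tgt D w (p : path D w) i l :
  itgt D ∘ seg p i l = isrc D ∘ p (i + l).
Proof.
elim: l i => [|l IH] i.
  by rewrite seg0 compose_A itgt_unit compose_1l addn0.
rewrite (segS (segS_compat p i l)) compose_A itgt_mul -compose_A pb_pair2 IH.
by rewrite addSnnS.
Qed.

Lemma seg1 D w (p : path D w) i : seg p i 1 = p i.
Proof.
rewrite (segS (segS_compat p i 0)).
have e : itgt D ∘ p i = isrc D ∘ (iunit D ∘ (itgt D ∘ p i)).
  by rewrite [RHS]compose_A isrc_unit compose_1l.
rewrite -[RHS](imul_1r e); congr (_ ∘ _); apply: pb_pair_congr => //.
by rewrite seg0 pe_next.
Qed.

Lemma seg_cat D w (p : path D w) i l l'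
    (e : itgt D ∘ seg p i l = isrc D ∘ seg p (i + l) l') :
  imul D ∘ pb_pair P e = seg p i (l + l').
Proof.
elim: l i e => [|l IH] i e.
  have e' : itgt D ∘ (iunit D ∘ (isrc D ∘ seg p i l')) = isrc D ∘ seg p i l'.
    by rewrite [LHS]compose_A itgt_unit compose_1l.
  rewrite -[RHS](imul_1l e'); congr (_ ∘ _); apply: pb_pair_congr.
    by rewrite seg0 seg_src.
  by rewrite addn0.
have e1 := segS_compat p i l.
have e2 : itgt D ∘ seg p i.+1 l = isrc D ∘ seg p (i.+1 + l) l'.
  by rewrite seg_tgt seg_src.
have e3 := segS_compat p i (l + l').
have e4 : itgt D ∘ p i = isrc D ∘ (imul D ∘ pb_pair P e2) by rewrite IH.
have e5 : itgt D ∘ (imul D ∘ pb_pair P e1) = isrc D ∘ seg p (i.+1 + l) l'.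
  by rewrite -segS e addSnnS.
rewrite addSn (segS e3).
transitivity (imul D ∘ pb_pair P e4).
  rewrite -(imul_A e5); congr (_ ∘ _); apply: pb_pair_congr.
    exact: segS.
  by rewrite addSnnS.
by congr (_ ∘ _); apply: pb_pair_congr => //; apply: IH.
Qed.

Lemma seg_pre D w w' (p : path D w) (h : hom w' w) i l :
  seg (path_pre p h) i l = seg p i l ∘ h.
Proof.
elim: l i => [|l IH] i; first by rewrite !seg0 /= !compose_A.
have e := segS_compat p i l; have e' := segS_compat (path_pre p h) i l.
rewrite (segS e) (segS e') -compose_A; congr (_ ∘ _).
have e2 : itgt D ∘ (p i ∘ h) = isrc D ∘ (seg p i.+1 l ∘ h).
  by rewrite !compose_A e.
by rewrite (pb_pair_pre _ e2); apply: pb_pair_congr.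
Qed.

Lemma seg_map D E (F : InternalFunctor D E) w (p : path D w) i l :
  seg (path_map F p) i l = ifar F ∘ seg p i l.
Proof.
elim: l i => [|l IH] i.
  rewrite !seg0 /= (compose_A (isrc E)) if_src [RHS]compose_A if_unit.
  by rewrite -!compose_A.
have e := segS_compat p i l; have e' := segS_compat (path_map F p) i l.
rewrite (segS e) (segS e') compose_A if_mul -compose_A; congr (_ ∘ _).
apply: pb_ext; rewrite [RHS]compose_A /pb_map !(pb_pair1, pb_pair2).
  by rewrite -[RHS]compose_A pb_pair1.
by rewrite -[RHS]compose_A pb_pair2 IH.
Qed.

Lemma seg_ext D w (p q : path D w) i l :
  (forall k, p k = q k) -> seg p i l = seg q i l.
Proof.
move=> E; elim: l i => [|l IH] i; first by rewrite !seg0 E.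
have e := segS_compat p i l; have e' := segS_compat q i l.
by rewrite (segS e) (segS e'); congr (_ ∘ _); apply: pb_pair_congr.
Qed.

Definition path_restr D w (p : path D w) (a : nat -> nat)
  (ha : {homo a : i j / i <= j}) : path D w.
Proof.
refine {| pe := fun k => seg p (a k) (a k.+1 - a k) |}.
abstract (by move=> k; rewrite seg_tgt seg_src subnKC // ha).
Defined.

Lemma seg_restr D w (p : path D w) a (ha : {homo a : i j / i <= j}) i l :
  seg (path_restr p ha) i l = seg p (a i) (a (i + l) - a i).
Proof.
elim: l i => [|l IH] i.
  by rewrite !seg0 addn0 subnn /= seg0 seg_src.
have e := segS_compat (path_restr p ha) i l.
have h1 : a i <= a i.+1 := ha _ _ (leqnSn i).
have h2 : a i.+1 <= a (i.+1 + l) := ha _ _ (leq_addr l i.+1).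
have e' : itgt D ∘ seg p (a i) (a i.+1 - a i) =
   isrc D ∘ seg p (a i + (a i.+1 - a i)) (a (i.+1 + l) - a i.+1).
  by rewrite seg_tgt seg_src.
rewrite (segS e) -addSnnS.
have -> : a (i.+1 + l) - a i = (a i.+1 - a i) + (a (i.+1 + l) - a i.+1).
  by rewrite [RHS]addnC addnBA // subnK.
rewrite -(seg_cat e'); congr (_ ∘ _); apply: pb_pair_congr => //.
by rewrite IH subnKC.
Qed.

(* N_0 = D_0, N_1 = D_1 and N_{n+2} = D_1 x_{D_0} N_{n+1}, each with its
   "first vertex" map to D_0. *)
Fixpoint nerve_sig D (n : nat) : {x : A & hom x (iob D)} :=
  match n with
  | 0 => existT (fun x => hom x (iob D)) (iob D) (idm (iob D))
  | 1 => existT (fun x => hom x (iob D)) (iar D) (isrc D)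
  | S n' => existT (fun x => hom x (iob D))
       (pb P (itgt D) (projT2 (nerve_sig D n')))
       (isrc D ∘ pb_p1 P (itgt D) (projT2 (nerve_sig D n')))
  end.

Definition nerve_obj D n : A := projT1 (nerve_sig D n).
Definition nerve_first D n : hom (nerve_obj D n) (iob D) :=
  projT2 (nerve_sig D n).

(* The edges of the universal composable n-tuple; beyond the n-th one, units. *)
Fixpoint nerve_edge D n (k : nat) : hom (nerve_obj D n) (iar D) :=
  match n return hom (nerve_obj D n) (iar D) with
  | 0 => iunit D
  | S n' =>
    match n' as m return
      hom (nerve_obj D m) (iar D) -> hom (nerve_obj D m.+1) (iar D) with
    | 0 => fun _ => if k is 0 then idm (iar D) else iunit D ∘ itgt D
    | S m => fun rec =>
        if k is 0 then pb_p1 P (itgt D) (nerve_first D m.+1)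
        else rec ∘ pb_p2 P (itgt D) (nerve_first D m.+1)
    end (nerve_edge D n' k.-1)
  end.

Lemma nerve_edge_first D n : isrc D ∘ nerve_edge D n 0 = nerve_first D n.
Proof.
case: n => [|[|n]] /=; first exact: isrc_unit.
  exact: compose_1r.
by [].
Qed.

Lemma nerve_edge_next D n k :
  itgt D ∘ nerve_edge D n k = isrc D ∘ nerve_edge D n k.+1.
Proof.
elim: n k => [|[|n] IH] k /=; first by rewrite isrc_unit itgt_unit.
  by case: k => [|k]; rewrite ?compose_1r !compose_A isrc_unit
    ?itgt_unit compose_1l.
case: k => [|k].
  rewrite [LHS]pb_square compose_A; congr (_ ∘ _).
  exact: (esym (nerve_edge_first D n.+1)).
rewrite !compose_A; congr (_ ∘ _); exact: IH.
Qed.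

Definition nerve_path D n : path D (nerve_obj D n) :=
  {| pe := nerve_edge D n; pe_next := nerve_edge_next D n |}.

(* The map to N_n classifying the first n edges of a string. *)
Definition nerve_pair_sig D w n (p : path D w) :
  {h : hom w (nerve_obj D n) | nerve_first D n ∘ h = isrc D ∘ p 0}.
Proof.
elim: n p => [|[|n] IH] p.
- exists (isrc D ∘ p 0); abstract (by rewrite compose_1l).
- by exists (p 0).
- exists (pb_pair P
    (etrans (pe_next p 0) (esym (proj2_sig (IH (path_tail p)))))).
  abstract (by rewrite /nerve_first /= -compose_A pb_pair1).
Defined.

Definition nerve_pair D w n (p : path D w) : hom w (nerve_obj D n) :=
  proj1_sig (nerve_pair_sig n p).

Lemma nerve_pair_first D w n (p : path D w) :
  nerve_first D n ∘ nerve_pair n p = isrc D ∘ p 0.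
Proof. exact: (proj2_sig (nerve_pair_sig n p)). Qed.

Lemma nerve_pair_p1 D w n (p : path D w) :
  pb_p1 P (itgt D) (nerve_first D n.+1) ∘ nerve_pair n.+2 p = p 0.
Proof. by rewrite /nerve_pair /= pb_pair1. Qed.

Lemma nerve_pair_p2 D w n (p : path D w) :
  pb_p2 P (itgt D) (nerve_first D n.+1) ∘ nerve_pair n.+2 p =
  nerve_pair n.+1 (path_tail p).
Proof. by rewrite {1}/nerve_pair [nerve_pair_sig _ _]/= pb_pair2. Qed.

Lemma nerve_edge_pair D w n (p : path D w) k :
  nerve_edge D n k ∘ nerve_pair n p =
  if k < n then p k else iunit D ∘ (isrc D ∘ p n).
Proof.
elim: n p k => [|[|n] IH] p k //.
  case: k => [|k] /=; first by rewrite compose_1l.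
  by rewrite -compose_A -pe_next.
case: k => [|k]; first by rewrite ltn0Sn; apply: nerve_pair_p1.
transitivity (nerve_edge D n.+1 k ∘ nerve_pair n.+1 (path_tail p)).
  by rewrite -nerve_pair_p2 compose_A.
by rewrite IH.
Qed.

Lemma nerve_ext D w n (h h' : hom w (nerve_obj D n)) :
  nerve_first D n ∘ h = nerve_first D n ∘ h' ->
  (forall k, k < n -> nerve_edge D n k ∘ h = nerve_edge D n k ∘ h') -> h = h'.
Proof.
elim: n h h' => [|[|n] IH] h h' Hf He.
- by move: Hf; rewrite /nerve_first /= !compose_1l.
- by have := He 0 isT; rewrite /= !compose_1l.
apply: pb_ext; first exact: (He 0 isT).
apply: IH.
  rewrite !compose_A -(pb_square P) -!compose_A; congr (_ ∘ _).
  exact: (He 0 isT).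
by move=> k Hk; rewrite !compose_A; apply: (He k.+1).
Qed.

Lemma nerve_pair_ext D w n (p q : path D w) :
  isrc D ∘ p 0 = isrc D ∘ q 0 -> (forall k, k < n -> p k = q k) ->
  nerve_pair n p = nerve_pair n q.
Proof.
move=> H0 H; apply: nerve_ext; first by rewrite !nerve_pair_first.
by move=> k Hk; rewrite !nerve_edge_pair Hk H.
Qed.

Lemma nerve_pair_pre D w w' n (p : path D w) (h : hom w' w) :
  nerve_pair n p ∘ h = nerve_pair n (path_pre p h).
Proof.
apply: nerve_ext; first by rewrite compose_A !nerve_pair_first compose_A.
by move=> k Hk; rewrite compose_A !nerve_edge_pair Hk.
Qed.

(* A monotone map [m] -> [n], extended to be constant from m on. *)
Definition mono_ext m n (a : monotone m n) (k : nat) : nat :=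
  a (inord (minn k m)).

Lemma mono_ext_homo m n (a : monotone m n) :
  {homo mono_ext a : i j / i <= j}.
Proof.
move=> i j ij; apply: mfun_le.
rewrite !inordK ?ltnS ?geq_minr // leq_min geq_minr andbT.
exact: leq_trans (geq_minl _ _) ij.
Qed.

(* The usual operator: edge k of the result is the composite of the edges from
   vertex a(k) to vertex a(k+1), a unit if a(k) = a(k+1). *)
Definition nerve_act D m n (a : monotone m n) :
    hom (nerve_obj D n) (nerve_obj D m) :=
  nerve_pair m (path_restr (nerve_path D n) (@mono_ext_homo m n a)).

Lemma seg_nerve_pair D w n (p : path D w) i j : i <= j ->
  seg (nerve_path D n) i (j - i) ∘ nerve_pair n p =
  seg p (minn i n) (minn j n - minn i n).
Proof.
have hm : {homo (fun k => minn k n) : x y / x <= y}.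
  move=> x y xy; rewrite leq_min geq_minr andbT.
  exact: leq_trans (geq_minl _ _) xy.
move=> ij; rewrite -seg_pre.
rewrite -[in RHS](subnKC ij) -(seg_restr p hm); apply: seg_ext => k /=.
rewrite nerve_edge_pair; case: (boolP (k < n)) => [kn|].
  by rewrite (minn_idPl (ltnW kn)) (minn_idPl kn) subSnn seg1.
rewrite -leqNgt => kn.
by rewrite (minn_idPr kn) (minn_idPr (leqW kn)) subnn.
Qed.

Lemma mono_ext_le m n (a : monotone m n) k : mono_ext a k <= n.
Proof. by rewrite -ltnS; apply: ltn_ord. Qed.

Lemma nerve_act_pair D w m n (a : monotone m n) (p : path D w) :
  nerve_act D a ∘ nerve_pair n p =
  nerve_pair m (path_restr p (@mono_ext_homo m n a)).
Proof.
rewrite nerve_pair_pre; apply: nerve_pair_ext => [|k _] /=.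
  have := @seg_nerve_pair D w n p (mono_ext a 0) (mono_ext a 1)
     (mono_ext_homo a (leqnSn 0)).
  by rewrite !(minn_idPl (mono_ext_le a _)) => ->.
rewrite seg_nerve_pair ?(minn_idPl (mono_ext_le a _)) //.
exact: mono_ext_homo.
Qed.

Lemma nerve_pair_path D n : nerve_pair n (nerve_path D n) = idm _.
Proof.
apply: nerve_ext.
  by rewrite nerve_pair_first compose_1r /= nerve_edge_first.
by move=> k Hk; rewrite nerve_edge_pair Hk compose_1r.
Qed.

Lemma nerve_act_id D n : nerve_act D (mono_id n) = idm (nerve_obj D n).
Proof.
have E k : mono_ext (mono_id n) k = minn k n.
  by rewrite /mono_ext /= inordK // ltnS geq_minr.
rewrite -nerve_pair_path; apply: nerve_pair_ext => [|k kn] /=.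
  by rewrite seg_src E min0n.
by rewrite !E (minn_idPl kn) (minn_idPl (ltnW kn)) subSnn seg1.
Qed.

Lemma nerve_act_comp D l m n (a : monotone m n) (b : monotone l m) :
  nerve_act D (mono_comp a b) = nerve_act D b ∘ nerve_act D a.
Proof.
have E k : mono_ext (mono_comp a b) k = mono_ext a (mono_ext b k).
  have h : mono_ext b k <= m := mono_ext_le b k.
  by rewrite {1}/mono_ext [RHS]/mono_ext (minn_idPl h) /= inord_val.
rewrite [nerve_act D a in RHS]/nerve_act nerve_act_pair.
apply: nerve_pair_ext => [|k kn].
  by rewrite /= seg_src seg_restr seg_src E.
rewrite /= seg_restr !E subnKC //; exact: mono_ext_homo.
Qed.

Definition nerve_simplicial D : Functor (opposite Delta) A :=
  @MkFunctor (opposite Delta) A (nerve_obj D) (fun n m a => nerve_act D a)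
    (nerve_act_id D) (fun n m l b a => nerve_act_comp D a b).

(* F_0, F_1 and F_1 x F_{n+1} in degrees 0, 1 and n+2. *)
Definition nerve_map_sig D E (F : InternalFunctor D E) n :
  {h : hom (nerve_obj D n) (nerve_obj E n) |
    nerve_first E n ∘ h = ifob F ∘ nerve_first D n}.
Proof.
elim: n => [|[|n] IH].
- exists (ifob F); abstract (by rewrite compose_1l compose_1r).
- by exists (ifar F); apply: if_src.
- exists (pb_map P (if_tgt F) (proj2_sig IH)).
  abstract (by rewrite /nerve_first /= -compose_A pb_pair1 !compose_A if_src).
Defined.

Definition nerve_map D E (F : InternalFunctor D E) n :
    hom (nerve_obj D n) (nerve_obj E n) :=
  proj1_sig (nerve_map_sig F n).

Lemma nerve_map_first D E (F : InternalFunctor D E) n :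
  nerve_first E n ∘ nerve_map F n = ifob F ∘ nerve_first D n.
Proof. exact: (proj2_sig (nerve_map_sig F n)). Qed.

Lemma nerve_map_edge D E (F : InternalFunctor D E) n k :
  nerve_edge E n k ∘ nerve_map F n = ifar F ∘ nerve_edge D n k.
Proof.
elim: n k => [|[|n] IH] k; first by rewrite /= if_unit.
  case: k => [|k] /=; first by rewrite compose_1l compose_1r.
  by rewrite -compose_A if_tgt !compose_A if_unit.
case: k => [|k]; first by rewrite /nerve_map /= pb_pair1.
have E2 : pb_p2 P (itgt E) (nerve_first E n.+1) ∘ nerve_map F n.+2 =
    nerve_map F n.+1 ∘ pb_p2 P (itgt D) (nerve_first D n.+1).
  by rewrite {1}/nerve_map [nerve_map_sig _ _]/= pb_pair2.
transitivity (nerve_edge E n.+1 k ∘ nerve_map F n.+1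
                ∘ pb_p2 P (itgt D) (nerve_first D n.+1)).
  by rewrite -compose_A -E2 compose_A.
by rewrite IH -compose_A.
Qed.

Lemma nerve_mapE D E (F : InternalFunctor D E) n :
  nerve_map F n = nerve_pair n (path_map F (nerve_path D n)).
Proof.
apply: nerve_ext.
  rewrite nerve_map_first nerve_pair_first /= compose_A if_src -compose_A.
  by rewrite nerve_edge_first.
by move=> k Hk; rewrite nerve_map_edge nerve_edge_pair Hk.
Qed.

Lemma nerve_map_natural D E (F : InternalFunctor D E) m n (a : monotone m n) :
  nerve_map F m ∘ nerve_act D a = nerve_act E a ∘ nerve_map F n.
Proof.
rewrite [nerve_map F n]nerve_mapE nerve_act_pair.
apply: nerve_ext.
  rewrite compose_A nerve_map_first -compose_A !nerve_pair_first /=.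
  by rewrite seg_map [RHS]compose_A if_src -compose_A.
move=> k Hk; rewrite compose_A nerve_map_edge -compose_A.
by rewrite !nerve_edge_pair Hk /= seg_map.
Qed.

Definition nerve_nat D E (F : InternalFunctor D E) :
    NatTrans (nerve_simplicial D) (nerve_simplicial E) :=
  @MkNatTrans (opposite Delta) A (nerve_simplicial D) (nerve_simplicial E)
    (nerve_map F) (fun n m a => nerve_map_natural F a).

Definition nerve : Functor InternalCat (Simplicial A).
Proof.
refine (@MkFunctor InternalCat (Simplicial A) nerve_simplicial nerve_nat _ _).
- move=> D; apply: NatTrans_ext => n; apply: nerve_ext => [|k _] /=.
    by rewrite nerve_map_first compose_1l compose_1r.
  by rewrite nerve_map_edge compose_1l compose_1r.
- move=> D E F G H; apply: NatTrans_ext => n; apply: nerve_ext => [|k _] /=.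
    by rewrite nerve_map_first !compose_A nerve_map_first -!compose_A
       nerve_map_first.
  by rewrite nerve_map_edge !compose_A nerve_map_edge -!compose_A
     nerve_map_edge.
Defined.

End InternalCategories.

(* Small categories are presented by their sets of objects and of arrows, so
   that the strict pullbacks and the equalities of functors used in the theory
   of double categories need no transport between hom-sets.  [comp g f e] is
   "g after f". *)
Record SmallCat := MkSmallCat {
  Ob : Type;
  Ar : Type;
  dom : Ar -> Ob;
  cod : Ar -> Ob;
  ident : Ob -> Ar;
  comp : forall g f : Ar, dom g = cod f -> Ar;
  dom_ident : forall x, dom (ident x) = x;
  cod_ident : forall x, cod (ident x) = x;
  dom_comp : forall g f (e : dom g = cod f), dom (comp e) = dom f;
  cod_comp : forall g f (e : dom g = cod f), cod (comp e) = cod g;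
  comp_1l : forall f (e : dom (ident (cod f)) = cod f), comp e = f;
  comp_1r : forall f (e : dom f = cod (ident (dom f))), comp e = f;
  comp_A : forall h g f (ehg : dom h = cod g) (egf : dom g = cod f)
    (el : dom h = cod (comp egf)) (er : dom (comp ehg) = cod f),
    comp el = comp er
}.

Arguments ident {s} x.
Arguments comp {s} g f e.

Record SmallFunctor (A B : SmallCat) := MkSmallFunctor {
  fo : Ob A -> Ob B;
  fa : Ar A -> Ar B;
  fa_dom : forall f, dom (fa f) = fo (dom f);
  fa_cod : forall f, cod (fa f) = fo (cod f);
  fa_ident : forall x, fa (ident x) = ident (fo x);
  fa_comp : forall g f (e : dom g = cod f) (e' : dom (fa g) = cod (fa f)),
    fa (comp g f e) = comp (fa g) (fa f) e'
}.

Arguments fa_comp {A B} s {g f} e e'.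

Lemma SmallFunctor_ext A B (F G : SmallFunctor A B) :
  (forall x, fo F x = fo G x) -> (forall f, fa F f = fa G f) -> F = G.
Proof.
case: F G => [F0 F1 a b c d] [G0 G1 a' b' c' d'] /= E0 E1.
have {}E0 : F0 = G0 by apply: functional_extensionality.
have {}E1 : F1 = G1 by apply: functional_extensionality.
case: _ / E0 a' b' c' d' => a' b' c' d'; case: _ / E1 a' b' c' d' => a' b' c' d'.
by congr MkSmallFunctor; apply: proof_irrelevance.
Qed.

Lemma comp_congr (A : SmallCat) (g f g' f' : Ar A) (e : dom g = cod f)
    (e' : dom g' = cod f') :
  g = g' -> f = f' -> comp g f e = comp g' f' e'.
Proof. by move=> Eg Ef; subst; congr comp; apply: proof_irrelevance. Qed.

Definition small_id A : SmallFunctor A A.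
Proof.
refine {| fo := fun x => x; fa := fun f => f |} => //.
by move=> g f e e'; apply: comp_congr.
Defined.

Definition small_comp A B C (G : SmallFunctor B C) (F : SmallFunctor A B) :
  SmallFunctor A C.
Proof.
refine {| fo := fun x => fo G (fo F x); fa := fun f => fa G (fa F f) |}.
- abstract (by move=> f; rewrite !fa_dom).
- abstract (by move=> f; rewrite !fa_cod).
- abstract (by move=> x; rewrite !fa_ident).
- move=> g f e e'.
  have e1 : dom (fa F g) = cod (fa F f) by rewrite fa_dom fa_cod e.
  by rewrite (fa_comp F e e1) (fa_comp G e1 e').
Defined.

Definition Cat : Category.
Proof.
refine {| obj := SmallCat; hom := SmallFunctor;
          idm := small_id; compose := small_comp |};
  by move=> *; apply: SmallFunctor_ext.
Defined.

Lemma sig_ext (T : Type) (Q : T -> Prop) (x y : {t | Q t}) :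
  proj1_sig x = proj1_sig y -> x = y.
Proof.
case: x y => [x Hx] [y Hy] /= E; subst y; congr exist.
exact: proof_irrelevance.
Qed.

Section CatPullback.
Variables (A B C : SmallCat) (F : SmallFunctor A C) (G : SmallFunctor B C).

Definition cat_pb_ob := {p : Ob A * Ob B | fo F p.1 = fo G p.2}.
Definition cat_pb_ar := {p : Ar A * Ar B | fa F p.1 = fa G p.2}.

Definition cat_pb_dom (f : cat_pb_ar) : cat_pb_ob.
Proof.
exists (dom (sval f).1, dom (sval f).2).
abstract (by rewrite -!fa_dom (proj2_sig f)).
Defined.

Definition cat_pb_cod (f : cat_pb_ar) : cat_pb_ob.
Proof.
exists (cod (sval f).1, cod (sval f).2).
abstract (by rewrite -!fa_cod (proj2_sig f)).
Defined.

Definition cat_pb_ident (x : cat_pb_ob) : cat_pb_ar.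
Proof.
exists (ident (sval x).1, ident (sval x).2).
abstract (by rewrite !fa_ident (proj2_sig x)).
Defined.

Definition cat_pb_comp (g f : cat_pb_ar) (e : cat_pb_dom g = cat_pb_cod f) :
  cat_pb_ar.
Proof.
exists (comp (sval g).1 (sval f).1 (congr1 (fun p => (sval p).1) e),
        comp (sval g).2 (sval f).2 (congr1 (fun p => (sval p).2) e)) => /=.
move: (congr1 _ _) (congr1 _ _) => /= e2 e1.
have e3 : dom (fa F (sval g).1) = cod (fa F (sval f).1).
  by rewrite fa_dom fa_cod e1.
have e4 : dom (fa G (sval g).2) = cod (fa G (sval f).2).
  by rewrite fa_dom fa_cod e2.
rewrite (fa_comp F e1 e3) (fa_comp G e2 e4).
by apply: comp_congr; [exact: (proj2_sig g) | exact: (proj2_sig f)].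
Defined.

Lemma pair_eq (S T : Type) (p q : S * T) : p.1 = q.1 -> p.2 = q.2 -> p = q.
Proof. by case: p q => [? ?] [? ?] /= -> ->. Qed.

Definition cat_pb : SmallCat.
Proof.
refine {| Ob := cat_pb_ob; Ar := cat_pb_ar; dom := cat_pb_dom;
          cod := cat_pb_cod; ident := cat_pb_ident; comp := cat_pb_comp |}.
- by move=> x; apply: sig_ext; apply: pair_eq; rewrite /= dom_ident.
- by move=> x; apply: sig_ext; apply: pair_eq; rewrite /= cod_ident.
- by move=> g f e; apply: sig_ext; apply: pair_eq; apply: dom_comp.
- by move=> g f e; apply: sig_ext; apply: pair_eq; apply: cod_comp.
- by move=> f e; apply: sig_ext; apply: pair_eq; apply: comp_1l.
- by move=> f e; apply: sig_ext; apply: pair_eq; apply: comp_1r.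
- by move=> *; apply: sig_ext; apply: pair_eq; apply: comp_A.
Defined.

Definition cat_pb_p1 : SmallFunctor cat_pb A.
Proof.
refine {| fo := fun x : Ob cat_pb => (sval x).1;
          fa := fun f : Ar cat_pb => (sval f).1 |} => //.
by move=> *; apply: comp_congr.
Defined.

Definition cat_pb_p2 : SmallFunctor cat_pb B.
Proof.
refine {| fo := fun x : Ob cat_pb => (sval x).2;
          fa := fun f : Ar cat_pb => (sval f).2 |} => //.
by move=> *; apply: comp_congr.
Defined.

Lemma cat_pb_square : small_comp F cat_pb_p1 = small_comp G cat_pb_p2.
Proof. by apply: SmallFunctor_ext => x; exact: (proj2_sig x). Qed.

Definition cat_pb_pair (W : SmallCat) (H : SmallFunctor W A)
  (K : SmallFunctor W B) (e : small_comp F H = small_comp G K) :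
  SmallFunctor W cat_pb.
Proof.
refine {| fo := fun x => exist _ (fo H x, fo K x)
                           (congr1 (fun L => fo L x) e) : Ob cat_pb;
          fa := fun f => exist _ (fa H f, fa K f)
                           (congr1 (fun L => fa L f) e) : Ar cat_pb |}.
- by move=> f; apply: sig_ext; apply: pair_eq; rewrite /= fa_dom.
- by move=> f; apply: sig_ext; apply: pair_eq; rewrite /= fa_cod.
- by move=> x; apply: sig_ext; apply: pair_eq; rewrite /= fa_ident.
- by move=> *; apply: sig_ext; apply: pair_eq; apply: fa_comp.
Defined.

Lemma cat_pb_ext (W : SmallCat) (H K : SmallFunctor W cat_pb) :
  small_comp cat_pb_p1 H = small_comp cat_pb_p1 K ->
  small_comp cat_pb_p2 H = small_comp cat_pb_p2 K -> H = K.
Proof.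
move=> E1 E2; apply: SmallFunctor_ext => x; apply: sig_ext; apply: pair_eq.
- exact: (congr1 (fun L => fo L x) E1).
- exact: (congr1 (fun L => fo L x) E2).
- exact: (congr1 (fun L => fa L x) E1).
- exact: (congr1 (fun L => fa L x) E2).
Qed.

End CatPullback.

Definition cat_pullbacks : Pullbacks Cat.
Proof.
refine (@MkPullbacks Cat (@cat_pb) (@cat_pb_p1) (@cat_pb_p2)
          (@cat_pb_square) (@cat_pb_pair) _ _ (@cat_pb_ext)).
- by move=> *; apply: SmallFunctor_ext.
- by move=> *; apply: SmallFunctor_ext.
Defined.

Definition is_iso (A : SmallCat) (f : Ar A) : Prop :=
  exists (g : Ar A) (egf : dom g = cod f) (efg : dom f = cod g),
    comp g f egf = ident (dom f) /\ comp f g efg = ident (dom g).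

Definition nat_iso (A B : SmallCat) (F G : SmallFunctor A B) : Prop :=
  exists eta : Ob A -> Ar B,
    (forall x, [/\ dom (eta x) = fo F x, cod (eta x) = fo G x
                 & is_iso (eta x)]) /\
    (forall (f : Ar A) (e : dom (eta (cod f)) = cod (fa F f))
        (e' : dom (fa G f) = cod (eta (dom f))),
      comp (eta (cod f)) (fa F f) e = comp (fa G f) (eta (dom f)) e').

Definition equivalence (A B : SmallCat) (F : SmallFunctor A B) : Prop :=
  exists G : SmallFunctor B A,
    nat_iso (small_comp G F) (small_id A) /\
    nat_iso (small_comp F G) (small_id B).

Definition isofibration (A B : SmallCat) (F : SmallFunctor A B) : Prop :=
  forall (a : Ob A) (b : Ar B), is_iso b -> cod b = fo F a ->
    exists a' : Ar A, [/\ is_iso a', cod a' = a & fa F a' = b].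

Record face (n : nat) := MkFace {
  fdim : nat;
  finc : monotone fdim n;
  fdim_lt : fdim < n;
  finc_inj : injective finc
}.

Section Matching.
Variables (X : Functor (opposite Delta) Cat) (n : nat).

Definition sact (m k : nat) (a : monotone m k) : SmallFunctor (X k) (X m) :=
  @fmap (opposite Delta) Cat X k m a.

(* M_n X is the limit of the X_k over the proper injections [k] -> [n], i.e.
   the category of compatible families indexed by these. *)
Definition matching_ob :=
  {x : forall a : face n, Ob (X (fdim a)) |
    forall (a b : face n) (s : monotone (fdim a) (fdim b)),
      mono_comp (finc b) s = finc a -> fo (sact s) (x b) = x a}.

Definition matching_ar :=
  {f : forall a : face n, Ar (X (fdim a)) |
    forall (a b : face n) (s : monotone (fdim a) (fdim b)),
      mono_comp (finc b) s = finc a -> fa (sact s) (f b) = f a}.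

Definition matching_dom (f : matching_ar) : matching_ob.
Proof.
exists (fun a => dom (sval f a)).
abstract (by move=> a b s e; rewrite -fa_dom (proj2_sig f a b s e)).
Defined.

Definition matching_cod (f : matching_ar) : matching_ob.
Proof.
exists (fun a => cod (sval f a)).
abstract (by move=> a b s e; rewrite -fa_cod (proj2_sig f a b s e)).
Defined.

Definition matching_ident (x : matching_ob) : matching_ar.
Proof.
exists (fun a => ident (sval x a)).
abstract (by move=> a b s e; rewrite fa_ident (proj2_sig x a b s e)).
Defined.

Definition matching_comp (g f : matching_ar)
  (e : matching_dom g = matching_cod f) : matching_ar.
Proof.
exists (fun a => comp (sval g a) (sval f a) (congr1 (fun x => sval x a) e)).
move=> a b s es.
have e' : dom (fa (sact s) (sval g b)) = cod (fa (sact s) (sval f b)).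
  by rewrite fa_dom fa_cod (congr1 (fun x => sval x b) e : dom _ = cod _).
rewrite (fa_comp _ _ e'); apply: comp_congr.
  exact: (proj2_sig g a b s es).
exact: (proj2_sig f a b s es).
Defined.

Definition matching : SmallCat.
Proof.
refine {| Ob := matching_ob; Ar := matching_ar; dom := matching_dom;
          cod := matching_cod; ident := matching_ident;
          comp := matching_comp |};
  move=> *; apply: sig_ext; apply: functional_extensionality_dep => a /=.
- exact: dom_ident.
- exact: cod_ident.
- exact: dom_comp.
- exact: cod_comp.
- exact: comp_1l.
- exact: comp_1r.
- exact: comp_A.
Defined.

Definition matching_map : SmallFunctor (X n) matching.
Proof.
unshelve refine
  {| fo := fun x => exist _ (fun a : face n => fo (sact (finc a)) x) _
             : Ob matching;
     fa := fun f => exist _ (fun a : face n => fa (sact (finc a)) f) _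
             : Ar matching |}.
- move=> a b s <-.
  by rewrite /sact (@fmap_comp (opposite Delta) Cat X _ _ _ s (finc b)).
- move=> a b s <-.
  by rewrite /sact (@fmap_comp (opposite Delta) Cat X _ _ _ s (finc b)).
- move=> f; apply: sig_ext; apply: functional_extensionality_dep => a.
  exact: fa_dom.
- move=> f; apply: sig_ext; apply: functional_extensionality_dep => a.
  exact: fa_cod.
- move=> x; apply: sig_ext; apply: functional_extensionality_dep => a.
  exact: fa_ident.
- move=> g f e e'; apply: sig_ext; apply: functional_extensionality_dep => a.
  exact: fa_comp.
Defined.

End Matching.

Section Reedy.
Variables (X Y : Functor (opposite Delta) Cat) (f : NatTrans X Y).

Definition level (n : nat) : SmallFunctor (X n) (Y n) := f n.

Lemma level_sact m n (s : monotone m n) :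
  small_comp (sact Y s) (level n) = small_comp (level m) (sact X s).
Proof. exact: (esym (@naturality _ _ _ _ f n m s)). Qed.

Definition matching_fun (n : nat) : SmallFunctor (matching X n) (matching Y n).
Proof.
unshelve refine
  {| fo := fun x : Ob (matching X n) =>
       exist _ (fun a : face n => fo (level (fdim a)) (sval x a)) _
       : Ob (matching Y n);
     fa := fun g : Ar (matching X n) =>
       exist _ (fun a : face n => fa (level (fdim a)) (sval g a)) _
       : Ar (matching Y n) |}.
- move=> a b s e /=; rewrite -(proj2_sig x a b s e).
  exact: (congr1 (fun L => fo L (sval x b)) (level_sact s)).
- move=> a b s e /=; rewrite -(proj2_sig g a b s e).
  exact: (congr1 (fun L => fa L (sval g b)) (level_sact s)).
- move=> g; apply: sig_ext; apply: functional_extensionality_dep => a.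
  exact: fa_dom.
- move=> g; apply: sig_ext; apply: functional_extensionality_dep => a.
  exact: fa_cod.
- move=> x; apply: sig_ext; apply: functional_extensionality_dep => a.
  exact: fa_ident.
- move=> h g e e'; apply: sig_ext; apply: functional_extensionality_dep => a.
  exact: fa_comp.
Defined.

Lemma relative_matching_square n :
  small_comp (matching_map Y n) (level n) =
  small_comp (matching_fun n) (matching_map X n).
Proof.
apply: SmallFunctor_ext => x; apply: sig_ext;
  apply: functional_extensionality_dep => a.
- exact: (congr1 (fun L => fo L x) (level_sact (finc a))).
- exact: (congr1 (fun L => fa L x) (level_sact (finc a))).
Qed.

(* The functor X_n -> Y_n x_{M_n Y} M_n X. *)
Definition relative_matching_map (n : nat) :
    SmallFunctor (X n) (cat_pb (matching_map Y n) (matching_fun n)) :=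
  cat_pb_pair (relative_matching_square n).

Definition reedy_weq : Prop := forall n : nat, equivalence (level n).

Definition reedy_fib : Prop :=
  forall n : nat, isofibration (relative_matching_map n).

End Reedy.

(* A double category is an internal category in Cat: [iob] is the category of
   objects and vertical morphisms, [iar] that of horizontal morphisms and
   squares. *)
Definition DblCat : Category := InternalCat cat_pullbacks.

Definition Nh : Functor DblCat (Simplicial Cat) := nerve cat_pullbacks.

(* Main.v *)
(* An arrow of N_2 is determined by its two short edges, so the Reedy condition
   in degree 2 forces every globular invertible square that a fibration sends to
   an identity to be an identity itself.  Let D have one object, one horizontal
   and one vertical morphism, and squares Z/2; factor the endomorphism of D that
   sends all squares to the identity as an acyclic cofibration i followed by a
   fibration p.  The nontrivial square g of D is a globular involution and
   p (i g) is an identity, so i g is an identity, whereas i is faithful on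
   squares, being a levelwise equivalence. *)

From Stdlib Require Import FunctionalExtensionality.
From mathcomp Require Import all_boot.
Require Import Defs.

Set Implicit Arguments.
Unset Strict Implicit.
Unset Printing Implicit Defensive.

Local Open Scope category_scope.

(** * The double category with squares Z/2 and its collapsing endomorphism *)

Lemma unit_eq (x y : unit) : x = y.
Proof. by case: x y => [] []. Qed.

Definition point : SmallCat.
Proof.
by refine {| Ob := unit; Ar := unit; dom := id; cod := id; ident := id;
             comp := fun _ _ _ => tt |} => *; apply: unit_eq.
Defined.

Definition BZ2 : SmallCat.
Proof.
refine {| Ob := unit; Ar := bool; dom := fun=> tt; cod := fun=> tt;
          ident := fun=> false; comp := fun g f _ => g (+) f |} => *.
- exact: unit_eq.
- exact: unit_eq.
- by [].
- by [].
- exact: addFb.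
- exact: addbF.
- exact: addbA.
Defined.

Definition to_point (A : SmallCat) : SmallFunctor A point.
Proof.
by refine {| fo := fun=> tt : Ob point; fa := fun=> tt : Ar point |}.
Defined.

Definition const_BZ2 (A : SmallCat) : SmallFunctor A BZ2.
Proof.
by refine {| fo := fun=> tt : Ob BZ2; fa := fun=> false : Ar BZ2 |}.
Defined.

(* Interchange holds because Z/2 is commutative (Eckmann-Hilton). *)
Definition square_mul :
  SmallFunctor (cat_pb (to_point BZ2) (to_point BZ2)) BZ2.
Proof.
refine {| fo := fun=> tt : Ob BZ2;
          fa := fun f : Ar (cat_pb (to_point BZ2) (to_point BZ2)) =>
                  (sval f).1 (+) (sval f).2 : Ar BZ2 |} => //.
by move=> g f e e' /=; rewrite addbACA.
Defined.

Definition Z2_squares : DblCat.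
Proof.
refine (@MkInternal Cat cat_pullbacks point BZ2 (to_point BZ2) (to_point BZ2)
          (const_BZ2 point) square_mul _ _ _ _ _ _ _).
- by apply: SmallFunctor_ext => x; apply: unit_eq.
- by apply: SmallFunctor_ext => x; apply: unit_eq.
- by apply: SmallFunctor_ext => x; apply: unit_eq.
- by apply: SmallFunctor_ext => x; apply: unit_eq.
- move=> W f e; apply: SmallFunctor_ext => x /=; [exact: unit_eq | by []].
- move=> W f e; apply: SmallFunctor_ext => x /=; [exact: unit_eq | exact: addbF].
- move=> W f g h efg egh el er; apply: SmallFunctor_ext => x //=.
  by rewrite addbA.
Defined.

Definition collapse : hom Z2_squares Z2_squares.
Proof.
unshelve refine (@MkInternalFunctor Cat cat_pullbacks Z2_squares Z2_squares
  (small_id point) (const_BZ2 BZ2) _ _ _ _).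
- by apply: SmallFunctor_ext => x; apply: unit_eq.
- by apply: SmallFunctor_ext => x; apply: unit_eq.
- exact: SmallFunctor_ext.
- exact: SmallFunctor_ext.
Defined.

Local Notation N D := (fobj Nh D).

(** * Edges of the nerve in degree 2 *)

Lemma level_comp (D E F : DblCat) (p : hom E F) (i : hom D E) n :
  level (fmap Nh (p ∘ i)) n =
  small_comp (level (fmap Nh p) n) (level (fmap Nh i) n).
Proof. by rewrite /level (fmap_comp Nh). Qed.

Lemma nerve_act_edge (A : Category) (P : Pullbacks A) (D : InternalCategory P)
    n (a : monotone 1 n) (i : nat) :
  a ord0 = i :> nat -> a ord_max = i.+1 :> nat ->
  nerve_act D a = nerve_edge D n i.
Proof.
move=> a0 a1.
have E0 : mono_ext a 0 = i.
  by rewrite /mono_ext -a0; congr (nat_of_ord (a _)); apply: val_inj; rewrite /= inordK.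
have E1 : mono_ext a 1 = i.+1.
  by rewrite /mono_ext -a1; congr (nat_of_ord (a _)); apply: val_inj; rewrite /= inordK.
by rewrite /nerve_act /nerve_pair /= E0 E1 subSnn seg1.
Qed.

Lemma edge_monotone_subproof (n : nat) (x y : 'I_n.+1) (xy : x <= y)
  (i j : 'I_2) : i <= j ->
  (if i == ord0 then x else y) <= (if j == ord0 then x else y).
Proof. by case: i j => [[|[|//]] ?] [[|[|//]] ?]. Qed.

Definition edge n (x y : 'I_n.+1) (xy : x <= y) : monotone 1 n :=
  MkMonotone (edge_monotone_subproof xy).

Lemma edge_inj n (x y : 'I_n.+1) (xy : x <= y) : x != y -> injective (edge xy).
Proof.
move=> ne [[|[|//]] ?] [[|[|//]] ?] //= E; apply: val_inj => //=.
  by rewrite E eqxx in ne.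
by rewrite E eqxx in ne.
Qed.

Definition edge_face (x y : 'I_3) (xy : x <= y) (ne : x != y) : face 2 :=
  @MkFace 2 1 (edge xy) isT (edge_inj ne).

Definition v0 : 'I_3 := @Ordinal 3 0 isT.
Definition v1 : 'I_3 := @Ordinal 3 1 isT.
Definition v2 : 'I_3 := @Ordinal 3 2 isT.
Definition d01 := @edge_face v0 v1 isT isT.
Definition d12 := @edge_face v1 v2 isT isT.
Definition d02 := @edge_face v0 v2 isT isT.

(** [N D 2] is a pullback of two copies of the category of squares, and [d01] and [d12] act as its
    projections. *)
Lemma nerve2_ext (D : DblCat) (f g : Ar (N D 2)) :
  fa (sact (N D) (finc d01)) f = fa (sact (N D) (finc d01)) g ->
  fa (sact (N D) (finc d12)) f = fa (sact (N D) (finc d12)) g -> f = g.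
Proof.
have -> : sact (N D) (finc d01) = nerve_edge D 2 0
  by exact: (@nerve_act_edge _ _ D 2 (finc d01)).
have -> : sact (N D) (finc d12) = nerve_edge D 2 1
  by exact: (@nerve_act_edge _ _ D 2 (finc d12)).
by move=> E0 E1; apply: sig_ext; apply: pair_eq.
Qed.

(** * Boundaries of triangles in the matching object *)

Definition to_vertex m : monotone m 0 :=
  @MkMonotone m 0 (fun=> ord0) (fun _ _ _ => isT).

(* For m <> 1 the value is irrelevant: Ar (N_0) is a singleton and proper faces
   of [2] have dimension at most 1. *)
Definition square_at (b : bool) (m : nat) : Ar (N Z2_squares m) :=
  match m with
  | 1 => b
  | m => fa (sact (N Z2_squares) (to_vertex m)) tt
  end.

(** The face [d02] is recognised by its endpoints, which avoids comparing faces that carry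
    proofs. *)
Definition long_edge (b : bool) (a : face 2) : bool :=
  [&& b, finc a ord0 == v0 & finc a ord_max == v2].

Lemma injective_endo1 (s : monotone 1 1) : injective s -> s = mono_id 1.
Proof.
move=> sI; have ne01 : s ord0 != s ord_max by apply/eqP => /sI.
have le01 : s ord0 <= s ord_max by apply: mfun_le.
have [s0 s1] : s ord0 = ord0 /\ s ord_max = ord_max.
  move: ne01 le01; case: (s ord0) (s ord_max) => [[|[|//]] ?] [[|[|//]] ?] //=.
  by split; apply: val_inj.
apply: monotone_ext => -[[|[|//]] h] /=.
  by rewrite (_ : Ordinal h = ord0) //; apply: val_inj.
by rewrite (_ : Ordinal h = ord_max) //; apply: val_inj.
Qed.

(** Vertices carry no data because the category of objects is [point], so only pairs of edges impose
    a condition. *)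
Lemma triangle_subproof (b : bool) (a a' : face 2)
    (s : monotone (fdim a) (fdim a')) :
  mono_comp (finc a') s = finc a ->
  fa (sact (N Z2_squares) s) (square_at (long_edge b a') (fdim a')) =
  square_at (long_edge b a) (fdim a).
Proof.
case: a a' s => [[|[|//]] a ? aI] [[|[|//]] a' ? aI'] s /= e.
- exact: unit_eq.
- exact: unit_eq.
(* An injective edge cannot factor through a vertex. *)
- have s01 : s ord0 = s ord_max by rewrite [LHS]ord1 [RHS]ord1.
  have a01 : a ord0 = a ord_max by rewrite -e /= s01.
  by have := aI _ _ a01.
- have sI : injective s.
    by move=> i j sij; apply: (aI _ _); rewrite -e /= sij.
  have Es := injective_endo1 sI.
  have Ea : a = a' by rewrite -e Es; apply: monotone_ext.
  transitivity (long_edge b (@MkFace 2 1 a' isT aI')).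
    rewrite Es.
    exact: (congr1 (fun L => fa L _) (@fmap_id _ _ (N Z2_squares) 1)).
  by rewrite /long_edge /= Ea.
Qed.

(* The arrow of M_2 that is b on the long edge d02 and the identity on the short
   ones; it comes from N_2 only if b = false. *)
Definition triangle (b : bool) : Ar (matching (N Z2_squares) 2) :=
  exist _ (fun a : face 2 => square_at (long_edge b a) (fdim a))
    (@triangle_subproof b).

(** * Faithfulness of equivalences, and involutions *)

Lemma faithful_equivalence (A B : SmallCat) (F : SmallFunctor A B) (f g : Ar A) :
  equivalence F -> dom f = dom g -> cod f = cod g -> fa F f = fa F g -> f = g.
Proof.
case=> G [[eta [etaP etaN]] _] Ed Ec EF.
have [d_eta c_eta [k [ekd [edk [_ kd]]]]] := etaP (dom f).
have ef : dom f = cod (eta (dom f)) by rewrite c_eta.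
have eg : dom g = cod (eta (dom f)) by rewrite -Ed c_eta.
(* By naturality each side is [eta (cod f)] after the common image under [G] of
   [fa F f = fa F g]. *)
have El : comp f (eta (dom f)) ef = comp g (eta (dom f)) eg.
  have hf : dom (eta (cod f)) = cod (fa G (fa F f)).
    by have [-> _ _] := etaP (cod f); rewrite !fa_cod.
  have hg : dom (eta (cod g)) = cod (fa G (fa F g)).
    by have [-> _ _] := etaP (cod g); rewrite !fa_cod.
  have eg' : dom g = cod (eta (dom g)) by rewrite -Ed c_eta.
  transitivity (comp (eta (cod f)) (fa G (fa F f)) hf).
    exact: (esym (etaN f hf ef)).
  transitivity (comp (eta (cod g)) (fa G (fa F g)) hg).
    by apply: comp_congr; rewrite ?Ec ?EF.
  transitivity (comp g (eta (dom g)) eg'); first exact: (etaN g hg eg').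
  by apply: comp_congr; rewrite ?Ed.
(* The inverse [k] of [eta (dom f)] cancels it on the right. *)
have cancel h (eh : dom h = cod (eta (dom f))) e1 :
    comp (comp h (eta (dom f)) eh) k e1 = h.
  have e2 : dom h = cod (comp (eta (dom f)) k edk) by rewrite cod_comp.
  have e3 : dom h = cod (ident (dom h)) by rewrite cod_ident.
  by rewrite -(comp_A e2 e1) -[RHS](comp_1r e3); apply: comp_congr;
    rewrite // kd ekd eh.
have e1 h (eh : dom h = cod (eta (dom f))) :
  dom (comp h (eta (dom f)) eh) = cod k by rewrite dom_comp.
by rewrite -(cancel f ef (e1 f ef)) -[RHS](cancel g eg (e1 g eg));
  apply: comp_congr.
Qed.

(** An involution is its own inverse, so invertibility in pullbacks and matching objects is checked
    componentwise, with no family of inverses to assemble. *)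
Definition involution (A : SmallCat) (f : Ar A) : Prop :=
  exists e : dom f = cod f, comp f f e = ident (dom f).

Lemma involution_iso (A : SmallCat) (f : Ar A) : involution f -> is_iso f.
Proof. by case=> e fK; exists f, e, e. Qed.

Lemma involution_ident (A : SmallCat) (x : Ob A) : involution (ident x).
Proof.
have e : dom (ident x) = cod (ident x) by rewrite dom_ident cod_ident.
exists e; have e1 : dom (ident x) = cod (ident (dom (ident x))).
  by rewrite cod_ident.
rewrite dom_ident -[RHS](comp_1r e1); apply: comp_congr => //.
by rewrite dom_ident.
Qed.

Lemma involution_fa (A B : SmallCat) (F : SmallFunctor A B) (f : Ar A) :
  involution f -> involution (fa F f).
Proof.
case=> e fK; have e' : dom (fa F f) = cod (fa F f) by rewrite fa_dom fa_cod e.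
by exists e'; rewrite -(fa_comp F e) fK fa_ident fa_dom.
Qed.

Lemma involution_pb (A B C : SmallCat) (F : SmallFunctor A C)
    (G : SmallFunctor B C) (f : Ar (cat_pb F G)) :
  involution (sval f).1 -> involution (sval f).2 -> involution f.
Proof.
case=> e1 fK1 [e2 fK2].
have e : dom f = cod f by apply: sig_ext; apply: pair_eq.
exists e; apply: sig_ext; apply: pair_eq => /=.
  by rewrite -fK1; apply: comp_congr.
by rewrite -fK2; apply: comp_congr.
Qed.

Lemma involution_triangle (b : bool) : involution (triangle b).
Proof.
have T (a : face 2) (f : Ar (N Z2_squares (fdim a))) : involution f.
  case: a f => [[|[|//]] a ? aI] /= f; exists erefl; first exact: unit_eq.
  exact: addbb.
have e : dom (triangle b) = cod (triangle b).
  apply: sig_ext; apply: functional_extensionality_dep => a.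
  by have [] := T a (sval (triangle b) a).
exists e; apply: sig_ext; apply: functional_extensionality_dep => a /=.
by have [? <-] := T a (sval (triangle b) a); apply: comp_congr.
Qed.

(** * The lifting problem in degree 2 *)

Lemma not_reedy_fib (Z : DblCat) (i : hom Z2_squares Z) (p : hom Z Z2_squares) :
  p ∘ i = collapse -> equivalence (level (fmap Nh i) 1) ->
  ~ reedy_fib (fmap Nh p).
Proof.
move=> pi we /(_ 2) fib_p.
pose x : Ob (N Z2_squares 2) := exist _ (tt, tt) erefl.
pose ix := fo (level (fmap Nh i) 2) x.
pose t := fa (matching_fun (fmap Nh i) 2) (triangle true).
pose c := ident (fo (level (fmap Nh p) 2) ix).
(* Applying [p] to [t] gives the collapsed triangle, all of whose components are identities. *)
have cE : fa (matching_map (N Z2_squares) 2) c =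
          fa (matching_fun (fmap Nh p) 2) t.
  apply: sig_ext; apply: functional_extensionality_dep => a.
  have E := congr1 (fun L => fa L (square_at (long_edge true a) (fdim a)))
    (level_comp p i (fdim a)).
  rewrite [RHS](esym E) pi {E} [LHS]fa_ident.
  case: a => [[|[|//]] a ? aI] /=; first exact: unit_eq.
  by [].
pose b : Ar (cat_pb (matching_map (N Z2_squares) 2)
               (matching_fun (fmap Nh p) 2)) := exist _ (c, t) cE.
have bI : is_iso b.
  apply: involution_iso; apply: involution_pb; first exact: involution_ident.
  exact: involution_fa (involution_triangle true).
have bx : cod b = fo (relative_matching_map (fmap Nh p) 2) ix.
  apply: sig_ext; apply: pair_eq; first exact: cod_ident.
  apply: sig_ext; apply: functional_extensionality_dep => a.
  (* Both sides are images under [i], and the nerve of [Z2_squares] has a single object in degrees 0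
     and 1. *)
  rewrite [LHS]fa_cod.
  rewrite [RHS](congr1 (fun L => fo L x) (level_sact (fmap Nh i) (finc a))).
  by congr fo; case: a => [[|[|//]] a ? aI]; apply: unit_eq.
have [f [_ _ fb]] := fib_p _ _ bI bx.
have ft a : fa (sact (N Z) (finc a)) f = fa (level (fmap Nh i) (fdim a))
    (square_at (long_edge true a) (fdim a)).
  exact: (congr1 (fun g => sval (sval g).2 a) fb).
have gE a : fa (sact (N Z) (finc a)) (fa (level (fmap Nh i) 2) (ident x)) =
    fa (level (fmap Nh i) (fdim a)) (square_at false (fdim a)).
  transitivity (fa (level (fmap Nh i) (fdim a))
                  (fa (sact (N Z2_squares) (finc a)) (ident x))).
    exact: (congr1 (fun L => fa L (ident x))
              (level_sact (fmap Nh i) (finc a))).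
  rewrite [in LHS]fa_ident.
  by congr fa; case: a => [[|[|//]] a ? aI]; [apply: unit_eq|].
(* [long_edge true] is false on [d01] and [d12], so the lift [f] has the short edges of an
   identity. *)
have fE : f = fa (level (fmap Nh i) 2) (ident x).
  by apply: nerve2_ext; rewrite ft gE.
(* On the long edge, [i] now identifies the squares [false] and [true], against its faithfulness in
   degree 1. *)
have := ft d02; rewrite fE gE /= => /(faithful_equivalence we).
by move=> /(_ erefl erefl).
Qed.

Theorem theorem7p22 :
  ~ exists M : ModelStructure DblCat,
      forall (D E : DblCat) (K : hom D E),
        (weq M K <-> reedy_weq (fmap Nh K)) /\
        (fib M K <-> reedy_fib (fmap Nh K)).
Proof.
case=> M MP; have [Z [i [p [Kpi _ wi fp]]]] := factor_acyclic_cof M collapse.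
apply: (@not_reedy_fib Z i p (esym Kpi)).
  exact: ((proj1 (proj1 (MP _ _ i)) wi) 1).
exact: (proj1 (proj2 (MP _ _ p)) fp).
Qed.
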